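(* For all positive integers $n,r$, \[C_r(q)+q\sum_{k=1}^{r-1}C_{r-k}(q)\sum_{m=0}^{k-1}(q-1)^m\binom{k-1}{m}\binom{n-2r+2k-m}{k}=\sum_{m=0}^{r-1}(q-1)^m\binom{r-1}{m}\binom{n-m}{r-1}.\]
   Context: $q$ is an indeterminate. The Narayana polynomials are $C_0(q)=1$ and $C_n(q)=\sum_{k=1}^n \frac1n\binom{n}{k-1}\binom{n}{k}q^{k-1}$ for $n\ge1$. Binomial coefficients $\binom{x}{k}$ with integer $k\ge0$ and arbitrary (possibly negative) integer $x$ mean $x(x-1)\cdots(x-k+1)/k!$. *)

(* Defs.v *)
From mathcomp Require Import all_boot all_order all_algebra.

Set Implicit Arguments.
Unset Strict Implicit.
Unset Printing Implicit Defensive.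

Import GRing.Theory.
Local Open Scope ring_scope.

(* Binomial coefficient x (x - 1) ... (x - k + 1) / k! with an arbitrary,
   possibly negative, integer upper argument. *)
Definition binz (x : int) (k : nat) : rat :=
  (\prod_(i < k) (x - i%:Z))%:~R / (k`!)%:R.

(* The indeterminate q is 'X : {poly rat}. *)
Definition narayana (n : nat) : {poly rat} :=
  if n == 0%N then 1
  else \sum_(1 <= k < n.+1)
         (n%:R^-1 * 'C(n, k.-1)%:R * 'C(n, k)%:R) *: 'X^(k.-1).

(* Main.v *)
(* Let w(t) solve w = t phi(w) with phi(z) = (1 + z)(z + q).  Lagrange inversion
   gives [t^j] w = (1/j) [z^(j-1)] phi^j = q C_j(q) for j >= 1.  Both inner sums
   of the identity are diagonal coefficients: with H = (1 + z)^(n-2r+2), the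
   inner sum at k is [z^k] H phi^(k-1) and the right-hand side is
   [z^(r-1)] H phi^(r-1).  Put d(F) = sum_k t^k [z^k] F phi^k.  Then
   d(z F) = t d(phi F), which forces d(f F) = f(w) d(F).  Writing
   phi = q + z phi1, the recurrence phi^k = (q + z phi1) phi^(k-1) yields
   H(0) + q sum_(k>=1) t^k [z^k] H phi^(k-1) = (1 - t phi1(w)) d(H), and
   multiplying by w = t (q + w phi1(w)) turns the right-hand side into
   q t d(H); the identity is the coefficient of t^r, divided by q.
   Power series in t are represented by polynomials modulo t^N. *)

Require Import Defs.
From mathcomp Require Import all_boot all_order all_algebra ring zify.
Import GRing.Theory Num.Theory.
Local Open Scope ring_scope.

Set Implicit Arguments.
Unset Strict Implicit.
Unset Printing Implicit Defensive.

(** * Congruences modulo a power of the variable *)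

Definition vanish (R : nzRingType) (n : nat) (p : {poly R}) :=
  forall i, (i < n)%N -> p`_i = 0.

Lemma eq_vanish (R : nzRingType) n (p q : {poly R}) :
  p = q -> vanish n p -> vanish n q.
Proof. by move=> ->. Qed.

Lemma vanishD (R : nzRingType) n (p q : {poly R}) :
  vanish n p -> vanish n q -> vanish n (p + q).
Proof. by move=> Hp Hq i lt_in; rewrite coefD Hp ?Hq ?addr0. Qed.

Lemma vanishMl (R : nzRingType) n (p q : {poly R}) :
  vanish n q -> vanish n (p * q).
Proof.
move=> Hq i lt_in; rewrite coefM big1 // => j _.
by rewrite Hq ?mulr0 // (leq_ltn_trans (leq_subr _ _)).
Qed.

Lemma vanishN (R : nzRingType) n (p : {poly R}) : vanish n p -> vanish n (- p).
Proof. by move=> Hp i lt_in; rewrite coefN Hp ?oppr0. Qed.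

Lemma vanishXM (R : nzRingType) n (p : {poly R}) :
  vanish n p -> vanish n.+1 ('X * p).
Proof. by move=> Hp [|i] lt_in; rewrite coefXM //= Hp. Qed.

Lemma vanish_deriv (R : nzRingType) n (p : {poly R}) :
  vanish n.+1 p -> vanish n p^`().
Proof. by move=> Hp i lt_in; rewrite coef_deriv Hp ?mul0rn. Qed.

Lemma vanishW (R : nzRingType) m n (p : {poly R}) :
  (m <= n)%N -> vanish n p -> vanish m p.
Proof. by move=> le_mn Hp i lt_im; rewrite Hp ?(leq_trans lt_im). Qed.

(** The factor 1 - t g is a unit among power series. Without inverses: each pass through p = t g p
    raises the known order of p by one. *)
Lemma vanish_contract (R : nzRingType) n (p g : {poly R}) :
  vanish n (p - 'X * (g * p)) -> vanish n p.
Proof.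
move=> H; suff Hk k : (k <= n)%N -> vanish k p by exact: Hk.
elim: k => [|k IHk] lt_kn //.
rewrite -[p](subrK ('X * (g * p))); apply: vanishD; first exact: vanishW H.
by apply: vanishXM; apply: vanishMl; apply: IHk; apply: ltnW.
Qed.

(** * The fixed-point equation w = t phi(w) *)

Lemma factor_sub_horner (R : nzRingType) (p : {poly R}) (a : R) :
  exists q : {poly R}, p - p.[a]%:P = q * ('X - a%:P).
Proof. by apply/factor_theorem; rewrite /root hornerD hornerN hornerC subrr. Qed.

(** Fixed-point iteration, t-adically contracting: each step gains one correct coefficient of the
    power series w. *)
Definition lagr (R : nzRingType) (phi : {poly R}) (n : nat) : {poly R} :=
  iter n (fun w => 'X * (phi \Po w)) 0.

Lemma lagr_fix (R : comNzRingType) (phi : {poly R}) n :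
  vanish n (lagr phi n - 'X * (phi \Po lagr phi n)).
Proof.
elim: n => [|n IHn] //; rewrite {1}/lagr iterS -/(lagr phi n) -mulrBr.
(* Dividing phi(z) - phi(w_(n+1)) by z - w_(n+1) and evaluating at z = w_n reduces the claim to
   [IHn], as w_(n+1) = t phi(w_n). *)
apply: vanishXM; have [q Eq] := factor_sub_horner phi^:P (lagr phi n.+1).
have -> : (phi \Po lagr phi n) - (phi \Po lagr phi n.+1) =
          q.[lagr phi n] * (lagr phi n - lagr phi n.+1).
  by move/(congr1 (horner^~ (lagr phi n))): Eq; rewrite !hornerE.
exact: vanishMl.
Qed.

(** * Diagonal coefficients *)

(* d(F) modulo t^N: z is the outer variable, t the inner one. *)
Definition diag (R : nzRingType) N (phi : {poly R}) (F : {poly {poly R}}) :=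
  \sum_(k < N) 'X^k * (F * phi^:P ^+ k)`_k.

Lemma diagD (R : nzRingType) N (phi : {poly R}) F1 F2 :
  diag N phi (F1 + F2) = diag N phi F1 + diag N phi F2.
Proof.
by rewrite /diag -big_split; apply: eq_bigr => k _; rewrite mulrDl coefD mulrDr.
Qed.

Lemma diagN (R : nzRingType) N (phi : {poly R}) F :
  diag N phi (- F) = - diag N phi F.
Proof.
by rewrite /diag -sumrN; apply: eq_bigr => k _; rewrite mulNr coefN mulrN.
Qed.

Lemma diagB (R : nzRingType) N (phi : {poly R}) F1 F2 :
  diag N phi (F1 - F2) = diag N phi F1 - diag N phi F2.
Proof. by rewrite diagD diagN. Qed.

Lemma diagZ (R : comNzRingType) N (phi : {poly R}) c F :
  diag N phi (c%:P * F) = c * diag N phi F.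
Proof.
rewrite /diag mulr_sumr; apply: eq_bigr => k _.
by rewrite -mulrA coefCM mulrCA.
Qed.

Lemma coef_diagC (R : comNzRingType) N (phi f : {poly R}) k :
  (k < N)%N -> (diag N phi f^:P)`_k = (f * phi ^+ k)`_k.
Proof.
move=> lt_kN; rewrite /diag coef_sum (bigD1 (Ordinal lt_kN)) //= big1.
  by rewrite addr0 -rmorphXn -rmorphM coef_map coefXnM ltnn subnn coefC eqxx.
move=> i ne_ik; rewrite -rmorphXn -rmorphM coef_map coefMC coefXn.
by rewrite eq_sym -val_eqE /= in ne_ik *; rewrite (negPf ne_ik) mul0r.
Qed.

(** Shift the index: [z^(k+1)] z F phi^(k+1) = [z^k] (phi F) phi^k. Only the last term on the right,
    of order t^N, is left over. *)
Lemma diagX (R : comNzRingType) N (phi : {poly R}) F :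
  vanish N (diag N phi ('X * F) - 'X * diag N phi (phi^:P * F)).
Proof.
case: N => // N; rewrite /diag big_ord_recl big_ord_recr /=.
rewrite -!mulrA coefXM mulr0 add0r mulrDr opprD addrA mulr_sumr -sumrB big1.
  rewrite add0r mulrA -exprS => i lt_iN.
  by rewrite coefN coefXnM lt_iN oppr0.
move=> k _; rewrite /bump /= add1n -mulrA coefXM.
by rewrite /= [phi^:P * F]mulrC -mulrA -!exprS mulrA -exprS subrr.
Qed.

(** Write phi(z) = phi(w) + psi (z - w). By [diagX] and w = t phi(w), d(G (z - w)) is congruent to t
    d(G psi (z - w)), which has the same shape with an extra t. The induction on the order therefore
    quantifies over F. *)
Lemma diag_root (R : comNzRingType) N (phi : {poly R}) F :
  vanish N (diag N phi (F * ('X - (lagr phi N)%:P))).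
Proof.
set w := lagr phi N.
suff H k : (k <= N)%N -> forall F, vanish k (diag N phi (F * ('X - w%:P))).
  exact: H.
elim: k => [|k IHk] lt_kN G //.
have [psi Epsi] := factor_sub_horner phi^:P w.
have -> : diag N phi (G * ('X - w%:P)) =
    (diag N phi ('X * G) - 'X * diag N phi (phi^:P * G))
    - diag N phi G * (w - 'X * (phi \Po w))
    + 'X * diag N phi (G * psi * ('X - w%:P)).
  have -> : G * ('X - w%:P) = 'X * G - w%:P * G by ring.
  rewrite -(mulrA G) -Epsi.
  have -> : G * (phi^:P - phi^:P.[w]%:P) = phi^:P * G - phi^:P.[w]%:P * G.
    by ring.
  rewrite !diagB !diagZ /comp_poly; ring.
apply: vanishD; first apply: vanishD.
- by apply: vanishW (@diagX _ _ _ _).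
- by apply: vanishN; apply: vanishMl; apply: vanishW (@lagr_fix _ _ _).
- by apply: vanishXM; apply: IHk; apply: ltnW.
Qed.

Lemma diagM (R : comNzRingType) N (phi f : {poly R}) F :
  vanish N (diag N phi (f^:P * F) - (f \Po lagr phi N) * diag N phi F).
Proof.
have [q Eq] := factor_sub_horner f^:P (lagr phi N).
rewrite /comp_poly -diagZ -diagB -mulrBl Eq mulrAC.
exact: diag_root.
Qed.

(** * Lagrange inversion *)

Lemma diag1 (R : idomainType) N (phi : {poly R}) :
  (forall m, m.+1%:R != 0 :> R) ->
  vanish N (diag N phi 1 - 1 - 'X * diag N phi (phi^`())^:P).
Proof.
move=> R0 [|k] lt_kN; rewrite !coefB coefXM coef1 -(rmorph1 (map_poly polyC)) /=.
  by rewrite coef_diagC // mulr1 coef1 subr0 subrr.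
rewrite !coef_diagC ?(ltnW lt_kN) // mul1r subr0.
(* After scaling by k+1, both terms are [z^k] of the derivative of phi^(k+1). *)
apply: (mulfI (R0 k)); rewrite mulr0 mulrBr; apply/eqP; rewrite subr_eq0; apply/eqP.
by rewrite !mulr_natl -coef_deriv deriv_exp coefMn.
Qed.

(** Differentiating w = t phi(w) gives (1 - t phi'(w)) t w' = w, while [diag1] and [diagM] give (1 -
    t phi'(w)) d(1) = 1. Cancelling the unit, t w' = w d(1) = d(z). *)
Lemma diag_lagr (R : idomainType) N (phi : {poly R}) :
  (forall m, m.+1%:R != 0 :> R) ->
  vanish N ('X * (lagr phi N)^`() - diag N phi 'X).
Proof.
move=> R0; case: N => // N; set w := lagr phi _; set d := diag _ _.
have Hw : vanish N.+1 (w - 'X * (phi \Po w)) by apply: lagr_fix.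
have H1 : vanish N.+1 (d 1 - 1 - 'X * d (phi^`())^:P) by apply: diag1.
have HX : vanish N.+1 (d 'X - w * d 1).
  by have := @diagM _ N.+1 phi 'X 1; rewrite comp_polyX map_polyX mulr1.
have Hf : vanish N.+1 (d (phi^`())^:P - (phi^`() \Po w) * d 1).
  by have := @diagM _ N.+1 phi phi^`() 1; rewrite mulr1.
suff H : vanish N.+1 ('X * w^`() - w * d 1).
  by apply: eq_vanish (vanishD H (vanishN HX)); ring.
have Hw' := vanishXM (vanish_deriv Hw).
rewrite derivB derivM deriv_comp derivX in Hw'.
apply: (@vanish_contract _ _ _ (phi^`() \Po w)).
apply: eq_vanish (vanishD (vanishD Hw' (vanishN Hw))
  (vanishN (vanishMl w (vanishD H1 (vanishMl 'X Hf))))).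
ring.
Qed.

Lemma lagrange_inversion (R : idomainType) N (phi : {poly R}) k :
  (forall m, m.+1%:R != 0 :> R) -> (k.+1 < N)%N ->
  (lagr phi N)`_k.+1 *+ k.+1 = (phi ^+ k.+1)`_k.
Proof.
move=> R0 lt_kN; have := diag_lagr (N := N) phi R0 lt_kN.
rewrite coefB coefXM /= coef_deriv -(map_polyX polyC) coef_diagC // coefXM.
by move/eqP; rewrite subr_eq0 => /eqP.
Qed.

Lemma lagr_convolution (R : comNzRingType) (phi h : {poly R}) r : (0 < r)%N ->
  let w := lagr phi r.+1 in
  w`_r * h`_0
  + phi`_0 * \sum_(1 <= k < r) w`_(r - k) * (h * phi ^+ k.-1)`_k
  = phi`_0 * (h * phi ^+ r.-1)`_r.-1.
Proof.
case: r => // r _ w; set d := diag r.+2 phi.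
have [phi1 Ephi] : exists p, phi = (phi`_0)%:P + 'X * p.
  exists (drop_poly 1 phi); rewrite -{1}(poly_take_drop 1 phi) mulrC.
  by congr (_ + _); apply/polyP=> i; rewrite coef_take_poly coefC; case: i.
pose T : {poly R} := \poly_(k < r.+2)
  (if k is k'.+1 then phi`_0 * (h * phi ^+ k')`_k else h`_0).
have HT : vanish r.+2 (T - (d h^:P - 'X * d (phi1 * h)^:P)).
  move=> [|k] lt_k; rewrite !coefB coefXM coef_poly ?lt_k //=.
    by rewrite coef_diagC // expr0 mulr1 subr0 subrr.
  rewrite !coef_diagC ?(ltnW lt_k) //.
  have -> : h * phi ^+ k.+1 =
      (phi`_0)%:P * (h * phi ^+ k) + 'X * (phi1 * h * phi ^+ k).
    rewrite exprS {1}Ephi; ring.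
  by rewrite coefD coefCM coefXM /= addrK subrr.
have Hd : vanish r.+2 (d (phi1 * h)^:P - (phi1 \Po w) * d h^:P).
  by rewrite rmorphM; apply: diagM.
have Hw := @lagr_fix _ phi r.+2; rewrite -/w in Hw.
have Ew : phi \Po w = (phi`_0)%:P + w * (phi1 \Po w).
  by rewrite {1}Ephi comp_polyD comp_polyC comp_polyM comp_polyX.
(* Here T = (1 - t phi1(w)) d(h), and w - t w phi1(w) = t phi(0) by [Ew]. *)
have H : vanish r.+2 (w * T - (phi`_0)%:P * ('X * d h^:P)).
  apply: eq_vanish (vanishD (vanishMl w HT) (vanishD
    (vanishN (vanishMl (w * 'X) Hd)) (vanishMl (d h^:P) Hw))).
  by rewrite Ew; ring.
have w0 : w`_0 = 0 by rewrite /w /lagr iterS coefXM.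
clearbody w.
move/eqP: (H r.+1 (ltnSn _)); rewrite coefB subr_eq0 coefCM coefXM /= coef_diagC //.
(* The top term of the convolution drops out because w has no constant term. *)
move/eqP <-; rewrite coefMr big_ord_recl big_ord_recr /= subn0 /bump /= add1n subnn w0.
rewrite mul0r addr0 coef_poly /=; congr (_ + _).
rewrite big_add1 big_mkord mulr_sumr; apply: eq_bigr => k _ /=.
by rewrite /bump add1n coef_poly !ltnS (ltnW (ltn_ord k)) mulrCA.
Qed.

(** * Binomial series with integer exponents *)

Lemma binz0 x : binz x 0 = 1.
Proof. by rewrite /binz big_ord0 divr1. Qed.

Lemma binzS (x : int) k : binz (x + 1) k.+1 = binz x k.+1 + binz x k.
Proof.
(* Splitting off the first factor for x + 1 and the last one for x leaves the same product P. *)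
rewrite /binz big_ord_recl big_ord_recr /= subr0.
under eq_bigr => i _ do rewrite /bump /= add1n intS opprD addrA addrK.
set P := \prod_(i < k) _; rewrite factS natrM !intrM rmorphB rmorphD /=.
have f0 : (k`!)%:R != 0 :> rat by rewrite pnatr_eq0 -lt0n fact_gt0.
have k0 : k.+1%:R != 0 :> rat by rewrite pnatr_eq0.
by field; rewrite f0 nat1r.
Qed.

(* The truncation of (1 + z) ^ x below degree M; x may be negative. *)
Definition binz_poly (M : nat) (x : int) : {poly {poly rat}} :=
  \poly_(i < M) (binz x i)%:P.

(** Each factor 1 + z acts by Pascal's rule [binzS]; truncation disturbs only degrees from M on. *)
Lemma vanish_binz_poly M x c :
  vanish M (binz_poly M x * ('X + 1) ^+ c - binz_poly M (x + c%:Z)).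
Proof.
elim: c => [|c IHc]; first by rewrite expr0 mulr1 addr0 subrr => i; rewrite coef0.
have H1 :
    vanish M (binz_poly M (x + c%:Z) * ('X + 1) - binz_poly M (x + c.+1%:Z)).
  move=> i lt_i; rewrite -addn1 PoszD addrA coefB mulrDr mulr1 coefD coefMX.
  rewrite !coef_poly lt_i; case: i lt_i => [|i] lt_i /=.
    by rewrite !binz0 add0r subrr.
  by rewrite (ltnW lt_i) binzS rmorphD addrC [X in _ - X]addrC /= subrr.
apply: eq_vanish (vanishD (vanishMl ('X + 1) IHc) H1).
by rewrite exprS; ring.
Qed.

(** Expanding (1 + z + a)^k in powers of a leaves (1 + z)^(2k-m) beside a^m. *)
Lemma coef_binz_poly_mul M b k j (a : {poly rat}) : (j < M)%N ->
  (binz_poly M b * (('X + 1) * ('X + 1 + a%:P)) ^+ k)`_j =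
  \sum_(0 <= m < k.+1)
    a ^+ m * ('C(k, m)%:R)%:P * (binz (b + 2 * k%:Z - m%:Z) j)%:P.
Proof.
move=> lt_jM; rewrite exprMn [(_ + a%:P) ^+ k]exprDn !mulr_sumr coef_sum big_mkord.
apply: eq_bigr => m _; rewrite -mulrnAr -!mulrA.
have -> : binz_poly M b *
    (('X + 1) ^+ k * (('X + 1) ^+ (k - m) * (a%:P ^+ m *+ 'C(k, m)))) =
    (a ^+ m *+ 'C(k, m))%:P * (binz_poly M b * ('X + 1) ^+ (k + (k - m))).
  by rewrite exprD polyCMn polyC_exp; ring.
have := @vanish_binz_poly M b (k + (k - m)) j lt_jM.
rewrite coefB coefCM => /eqP; rewrite subr_eq0 => /eqP ->.
rewrite coef_poly lt_jM -[a ^+ m *+ _]mulr_natr polyC_natr -mulrA.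
by congr (_ * (_ * (binz _ _)%:P)); have := ltn_ord m; lia.
Qed.

(** * Narayana polynomials as coefficients of w *)

Lemma coef_XaddC_exp (R : comNzRingType) (c : R) n i :
  (('X + c%:P) ^+ n)`_i = c ^+ (n - i) *+ 'C(n, i).
Proof.
rewrite addrC exprDn.
rewrite (eq_bigr (fun i : 'I_n.+1 => (c ^+ (n - i) *+ 'C(n, i)) *: 'X^i)).
  rewrite -(poly_def _ (fun i => c ^+ (n - i) *+ 'C(n, i))) coef_poly ltnS.
  by case: ltnP => // lt_ni; rewrite bin_small.
by move=> k _; rewrite -polyC_exp mul_polyC scalerMnl.
Qed.

Lemma lagr_narayana N j : (0 < j < N)%N ->
  (lagr (('X + 1) * ('X + 1 + ('X - 1)%:P) : {poly {poly rat}}) N)`_j =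
  'X * narayana j.
Proof.
case: j => // j /andP[_ lt_jN].
have R0 m : m.+1%:R != 0 :> {poly rat} by rewrite -polyC_natr polyC_eq0 pnatr_eq0.
apply: (mulfI (R0 j)); rewrite mulr_natl lagrange_inversion //.
rewrite /narayana /= big_add1 mulrA mulr_sumr /= exprMn.
have -> : 'X + 1 + ('X - 1)%:P = 'X + 'X%:P :> {poly {poly rat}}.
  by rewrite polyCB polyC1; ring.
(* After reversal, term i is ['C(j.+1, i)] times ['C(j.+1, i.+1)] times q^(i+1). *)
rewrite coefMr (reindex_inj rev_ord_inj) /= big_mkord; apply: eq_bigr => i _.
have le_ij := ltn_ord i; rewrite ltnS in le_ij.
rewrite -polyC1 !coef_XaddC_exp expr1n !subSS subKn //.
rewrite -(subSS i j) bin_sub // subKn //.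
rewrite -polyC_natr -mulrA -polyC_natr; apply/polyP=> l.
rewrite !(coefCM, coefXM, coefMn, coefXn, coefZ).
case: l => [|l] /=; first by rewrite mul0rn !mulr0.
rewrite eqSS !mulrA mulfV ?pnatr_eq0 // mul1r -[_ *+ _]mulr_natr; ring.
Qed.

Theorem theorem4 (n r : nat) (hn : (0 < n)%N) (hr : (0 < r)%N) :
  narayana r
  + 'X * \sum_(1 <= k < r)
           narayana (r - k)
           * \sum_(0 <= m < k)
               ('X - 1) ^+ m * ('C(k.-1, m)%:R)%:P
               * (binz (n%:Z - 2 * r%:Z + 2 * k%:Z - m%:Z) k)%:P
  = \sum_(0 <= m < r)
      ('X - 1) ^+ m * ('C(r.-1, m)%:R)%:P
      * (binz (n%:Z - m%:Z) r.-1)%:P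
  :> {poly rat}.
Proof.
pose phi : {poly {poly rat}} := ('X + 1) * ('X + 1 + ('X - 1)%:P).
have phi0 : phi`_0 = 'X.
  by rewrite /phi coef0M !coefD coefX coef1 coefC /= !add0r mul1r addrC subrK.
(* The exponent makes b + 2(k-1) = n - 2r + 2k, and hence b + 2(r-1) = n. *)
pose b := n%:Z - 2 * r%:Z + 2; pose h := binz_poly r.+1 b.
have h0 : h`_0 = 1 by rewrite coef_poly binz0.
have Ew j : (0 < j <= r)%N -> (lagr phi r.+1)`_j = 'X * narayana j.
  exact: (@lagr_narayana r.+1).
have Eh k j : (j <= r)%N -> (h * phi ^+ k)`_j =
  \sum_(0 <= m < k.+1)
    ('X - 1) ^+ m * ('C(k, m)%:R)%:P * (binz (b + 2 * k%:Z - m%:Z) j)%:P.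
  exact: (@coef_binz_poly_mul r.+1).
(* Lagrange coefficients are q C_j(q), so the convolution yields the identity multiplied by q. *)
apply: (@mulfI _ 'X); first by rewrite polyX_eq0.
have := lagr_convolution phi h hr; rewrite /= phi0 h0 mulr1 Ew ?hr ?leqnn //.
rewrite Eh ?leq_pred // prednK // => H.
under [in RHS]eq_big_nat => m _.
  have -> : n%:Z - m%:Z = b + 2 * r.-1%:Z - m%:Z by rewrite /b; lia.
  over.
rewrite -{}H mulrDr; congr (_ + _); rewrite mulr_sumr; congr (_ * _).
apply: eq_big_nat => k /andP[k_gt0 lt_kr].
rewrite Ew ?subn_gt0 ?lt_kr ?leq_subr // Eh ?(ltnW lt_kr) // prednK // -mulrA.
congr (_ * (_ * _)); apply: eq_big_nat => m _.
by congr (_ * (binz _ _)%:P); rewrite /b; lia.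
Qed.
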